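(* Let $n$ and $k$ be two non-negative integers. There exists a universal constant $c(n,k)$, depending only on $n$ and $k$, such that for every polyhedron $P=\{x\in\mathbb{R}^n : Ax\le b\}$ (with $A\in\mathbb{R}^{m\times n}$, $b\in\mathbb{R}^m$, $m$ arbitrary) containing exactly $k$ integer points, there is a subset $S$ of the rows of $A$, of cardinality no more than $c(n,k)$, such that the polyhedron $\{x\in\mathbb{R}^n : A_S x\le b_S\}$ has exactly the same $k$ integer points as $P$. Moreover, the minimal such constant $c(n,k)$ satisfies $$c(n,k)\le \lceil 2(k+1)/3\rceil\, 2^n-2\lceil 2(k+1)/3\rceil+2,$$ i.e. the property above holds with a constant bounded by the right-hand side.
   Context: For $A\in\mathbb{R}^{m\times n}$, $b\in\mathbb{R}^m$ and $S\subseteq\{1,\dots,m\}$, $A_S$ denotes the $|S|\times n$ submatrix of $A$ with row indices in $S$, and $b_S$ the corresponding subvector of $b$. An integer point is an element of $\mathbb{Z}^n$. *)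

(* Defs.v *)
From HB Require Import structures.
From mathcomp Require Import all_boot all_order all_algebra.
From mathcomp Require Import all_classical all_reals.

Set Implicit Arguments.
Unset Strict Implicit.
Unset Printing Implicit Defensive.

Import Order.TTheory GRing.Theory Num.Theory.

Local Open Scope ring_scope.
Local Open Scope classical_set_scope.
Local Open Scope card_scope.

Definition polyhedron (R : realType) (m n : nat)
    (A : 'M[R]_(m, n)) (b : 'cV[R]_m) : set 'cV[R]_n :=
  [set x | forall i : 'I_m, (A *m x) i 0 <= b i 0].

Definition integer_points (R : realType) (n : nat) (X : set 'cV[R]_n) :
    set 'cV[R]_n :=
  X `&` [set x | forall j : 'I_n, x j 0 \is a Num.int].

(* Rows are kept in increasing order of their index in S. *)
Definition subrows (R : realType) (m p : nat) (S : {set 'I_m})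
    (M : 'M[R]_(m, p)) : 'M[R]_(#|S|, p) :=
  rowsub (@enum_val _ (mem S)) M.

(* The constant c is an integer rather than a natural number only because of
   the degenerate case n = 0, k >= 3: no polyhedron of R^0 contains k integer
   points, the property is vacuous, and [quant_bound 0 k] is negative.  As soon
   as some polyhedron contains exactly k integer points, the property forces
   0 <= c. *)
Definition quant_doignon_constant (R : realType) (n k : nat) (c : int) : Prop :=
  forall (m : nat) (A : 'M[R]_(m, n)) (b : 'cV[R]_m),
    integer_points (polyhedron A b) #= `I_k ->
    exists S : {set 'I_m},
      #|S|%:Z <= c /\
      integer_points (polyhedron (subrows S A) (subrows S b)) =
      integer_points (polyhedron A b).

Definition quant_bound (n k : nat) : int :=
  let q : int := Num.ceil (2 * (k%:R + 1) / 3 : rat) in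
  q * 2 ^+ n - 2 * q + 2.

(* Main.v *)
Require Import Defs.
From mathcomp Require Import all_boot all_order all_algebra.
From mathcomp Require Import all_classical all_reals.
From mathcomp Require Import zify lra.

Set Implicit Arguments.
Unset Strict Implicit.
Unset Printing Implicit Defensive.

Import Order.TTheory GRing.Theory Num.Theory.

(** It is enough to show that [quant_bound n k] itself has the required
    property.  Given the polyhedron, keep an inclusion-minimal set S of rows
    that does not change the integer points
    ([exists_irredundant_rows]).  By minimality each row i of S has a witness,
    an integer point violating row i and no other row of S.  The k integer
    points and these witnesses lie in a bounded grid of integer points, and the
    rest of the argument takes place in that grid, where minima are attained.

    Relax the right-hand sides of S one after the other, each as far as possible
    without admitting a new grid point ([exists_tight_witnesses]): row i becomes
    the strict inequality f_i < c_i, the solutions in the grid are still the k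
    given points Y, and now row i has a tight witness z_i, with f_i(z_i) = c_i
    and f_j(z_i) < c_j for the other rows j.  Let U consist of Y and of the
    #|S| points z_i.  The midpoint of two distinct points of U satisfies all
    the strict inequalities, since at most one of the two points is tight for a
    given row.  Hence, when the two points are congruent modulo 2, their
    midpoint is an integer point and belongs to Y.

    It remains to bound #|U| = #|S| + k, by counting in each of the 2^n parity
    classes ([leq_card_midpoint_closed]).  A class with r points has at least
    2r-3 midpoints, as one sees by ordering the points along a generic linear
    form w_1 < ... < w_r and listing the increasing sums w_i + w_(i+1),
    w_i + w_(i+2).  So 2r-3 <= k.  Moreover, the least point y of Y is not a
    midpoint of two points of its own class: a point w < y of that class would
    give the midpoint (w+y)/2 < y in Y, so all the other points of the class lie
    above y.  There 2r-3 <= k-1.  Summing up,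
    #|S| + k <= (2^n - 1) floor((k+3)/2) + floor((k+2)/2); as the two
    floors add up to k+2, this reads #|S| <= h (2^n - 2) + 2 with
    h = floor((k+3)/2), and h <= ceil(2(k+1)/3). *)

(** * Sums of pairs of natural numbers *)

(** For an increasing sequence s, the sums s_i + s_(i+1) and s_i + s_(i+2),
    interleaved so that they increase: a set of r numbers has at
    least 2r-3 sums of two distinct elements. *)
Fixpoint near_sums (s : seq nat) : seq nat :=
  if s is a :: s' then
    (if s' is b :: s'' then
       a + b :: (if s'' is c :: _ then [:: a + c] else [::])
     else [::]) ++ near_sums s'
  else [::].

Lemma near_sumsE a b s : near_sums [:: a, b & s] =
  a + b :: (if s is c :: _ then [:: a + c] else [::]) ++ near_sums (b :: s).
Proof. by []. Qed.

Lemma size_near_sums s : size (near_sums s) = 2 * size s - 3.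
Proof.
elim: s => [|a [|b [|c s]] IHs] //.
by rewrite near_sumsE -cat_cons size_cat IHs /=; lia.
Qed.

Lemma sorted_near_sums s : sorted ltn s -> sorted ltn (near_sums s).
Proof.
elim: s => [|a [|b [|c s]] IHs] // /andP[/= lt_ab srt_bs].
have /andP[/= lt_bc _] := srt_bs.
have := IHs srt_bs; rewrite !near_sumsE /= => ->.
by rewrite ltn_add2l lt_bc /= ltn_add2r lt_ab.
Qed.

Lemma near_sumsP s x : sorted ltn s -> x \in near_sums s ->
  exists a b, [/\ a \in s, b \in s, a < b & x = a + b].
Proof.
elim: s => [|a [|b s] IHs] // srt_s.
rewrite near_sumsE -cat_cons mem_cat => /orP[|x_in]; last first.
  have [a' [b' [a'_in b'_in lt_ab ->]]] := IHs (path_sorted srt_s) x_in.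
  by exists a', b'; rewrite !(in_cons a) a'_in b'_in !orbT.
have /andP[lt_ab srt_bs] := srt_s.
rewrite inE => /orP[/eqP->|]; first by exists a, b; rewrite !inE !eqxx orbT.
case: s srt_bs {IHs srt_s} => [//|c s] /andP[lt_bc _].
rewrite inE => /eqP->; exists a, c; split => //; last exact: ltn_trans lt_bc.
  by rewrite !inE eqxx.
by rewrite !inE eqxx !orbT.
Qed.

(** * Midpoints in a grid *)

Lemma base_expansion_inj N n (t u : 'I_n -> 'I_N) :
  \sum_(j < n) t j * N ^ j = \sum_(j < n) u j * N ^ j -> t =1 u.
Proof.
elim: n t u => [|n IHn] t u; first by move=> _ [].
have split_sum (w : 'I_n.+1 -> 'I_N) : \sum_(j < n.+1) w j * N ^ j =
    (\sum_(j < n) w (lift ord0 j) * N ^ j) * N + w ord0.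
  rewrite big_ord_recl expn0 muln1 addnC big_distrl; congr (_ + _).
  by apply: eq_bigr => j _; rewrite lift0 expnSr mulnA.
rewrite !split_sum => eq_sums.
have N_gt0 : 0 < N by apply: leq_trans (ltn_ord (t ord0)).
have eq0 : t ord0 = u ord0.
  apply: val_inj; have := congr1 (modn^~ N) eq_sums.
  by rewrite /= !modnMDl !modn_small.
move: eq_sums; rewrite eq0 => /addIn/eqP; rewrite eqn_pmul2r // => /eqP/IHn eqS.
by move=> j; case: (unliftP ord0 j) => [i ->|->] //; exact: eqS.
Qed.

Section Grid.
Variables n N : nat.
Notation grid := {ffun 'I_n -> 'I_N.+1}.
Implicit Types (t u w : grid) (U W Y : {set grid}).

Definition parity t : {ffun 'I_n -> bool} := [ffun j => odd (t j)].

(** The genuine midpoint only for points of equal parity: otherwise the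
    halves are rounded down. *)
Definition midpoint t u : grid := [ffun j => inord (t j + u j)./2].

(** A linear form that separates the points of the grid, so that midpoints can
    be counted by counting sums of natural numbers. *)
Definition code t : nat := \sum_j t j * N.+1 ^ j.

Lemma code_inj : injective code.
Proof. by move=> t u /base_expansion_inj eq_tu; apply/ffunP. Qed.

Lemma midpointE t u j : parity t = parity u ->
  (midpoint t u j).*2 = t j + u j.
Proof.
move=> /ffunP/(_ j); rewrite !ffunE => eq_odd.
have lt_t := ltn_ord (t j); have lt_u := ltn_ord (u j).
rewrite inordK; first by rewrite halfK oddD eq_odd addbb subn0.
lia.
Qed.

Lemma code_midpoint t u : parity t = parity u ->
  (code (midpoint t u)).*2 = code t + code u.
Proof.
move=> eq_par; rewrite -muln2 /code big_distrl -big_split /=.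
by apply: eq_bigr => j _; rewrite -mulnDl -midpointE // -muln2 mulnAC.
Qed.

(** The codes of the points of W, sorted, have 2 #|W| - 3 distinct sums of
    pairs, each of which is twice the code of a point of Y. *)
Lemma leq_card_midpoints W Y :
    {in W &, forall u w, parity u = parity w} ->
    {in W &, forall u w, u != w -> midpoint u w \in Y} ->
  2 * #|W| - 3 <= #|Y|.
Proof.
move=> parW midW; pose s := sort leq [seq code w | w in W].
have srt_s : sorted ltn s.
  rewrite ltn_sorted_uniq_leq sort_uniq sort_sorted ?andbT;
    last exact: leq_total.
  by rewrite map_inj_uniq ?enum_uniq //; exact: code_inj.
have size_s : size s = #|W| by rewrite size_sort size_map -cardE.
rewrite -size_s -size_near_sums cardE -(size_map (fun y => (code y).*2)).
apply: uniq_leq_size.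
  exact: (sorted_uniq ltn_trans ltnn (sorted_near_sums srt_s)).
move=> x /(near_sumsP srt_s)[a [b []]]; rewrite !mem_sort.
case/fintype.imageP=> u uW -> /fintype.imageP[w wW ->] lt_uw ->.
rewrite -code_midpoint ?(parW u w) //; apply: map_f.
rewrite mem_enum midW //; apply: contraL lt_uw => /eqP->.
by rewrite ltnn.
Qed.

(** Each parity class of U obeys [leq_card_midpoints].  The class of the point
    of least code in Y obeys it even with that point removed from Y, which
    accounts for the second term. *)
Lemma leq_card_midpoint_closed U Y :
    Y \subset U ->
    {in U &, forall u w, u != w -> parity u = parity w -> midpoint u w \in Y} ->
  #|U| <= (2 ^ n).-1 * (#|Y| + 3)./2 + (#|Y| + 2)./2.
Proof.
move=> subYU midU.
pose cls p := [set u in U | parity u == p].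
have parP p : {in cls p &, forall u w, parity u = parity w}.
  by move=> u w; rewrite !inE => /andP[_ /eqP->] /andP[_ /eqP->].
have midP p : {in cls p &, forall u w, u != w -> midpoint u w \in Y}.
  move=> u w uP wP; have := parP p u w uP wP.
  move: uP wP; rewrite !inE => /andP[uU _] /andP[wU _] eq_par ne.
  exact: midU.
have cls_le p : #|cls p| <= (#|Y| + 3)./2.
  have := leq_card_midpoints (@parP p) (@midP p); lia.
have [p0 cls0_le] : exists p0, #|cls p0| <= (#|Y| + 2)./2.
  have [Y0|[y yY]] := set_0Vmem Y.
    by exists [ffun=> false]; have := cls_le [ffun=> false]; rewrite Y0 cards0.
  (* All the points of the class of y0 have codes at least that of y0, so y0
     is not the midpoint of two distinct ones. *)
  case: (@arg_minnP _ y (mem Y) code yY) => y0 /= y0Y y0_min.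
  have {}y0Y : y0 \in Y by [].
  have y0U : y0 \in U by apply: (fintype.subsetP subYU).
  exists (parity y0).
  have y0_cls : y0 \in cls (parity y0) by rewrite inE y0U eqxx.
  have cls_min w : w \in cls (parity y0) -> code y0 <= code w.
    move=> w_cls; case: (eqVneq w y0) => [->//|ne_w].
    have := y0_min _ (midP _ _ _ w_cls y0_cls ne_w).
    have := code_midpoint (parP _ _ _ w_cls y0_cls); lia.
  have := @leq_card_midpoints (cls (parity y0)) (Y :\ y0) (@parP _) _.
  have := cardsD1 y0 Y; rewrite y0Y add1n => cardY.
  move=> le_mid; suff: 2 * #|cls (parity y0)| - 3 <= #|Y :\ y0|.
    by rewrite cardY; move: #|_ :\ _| #|cls _| => a c; lia.
  apply: le_mid => u w u_cls w_cls ne_uw.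
  rewrite !inE (midP (parity y0)) // andbT.
  apply/eqP => eq_mid; have := code_midpoint (parP _ _ _ u_cls w_cls).
  have ne_code : code u != code w by rewrite (inj_eq code_inj).
  rewrite eq_mid; have := cls_min u u_cls; have := cls_min w w_cls; lia.
have -> : #|U| = \sum_p #|cls p|.
  rewrite -sum1_card (partition_big parity predT) //=.
  apply: eq_bigr => p _; rewrite -sum1_card.
  by apply: eq_bigl => u; rewrite inE.
rewrite (bigD1 p0) //= addnC leq_add //.
have -> : (2 ^ n).-1 = #|predC1 p0|.
  by rewrite cardC1 card_ffun card_bool card_ord.
by rewrite -sum_nat_const leq_sum.
Qed.

End Grid.

(** * Relaxing a system of constraints *)

Section TightWitnesses.
Local Open Scope order_scope.
Variables (d : Order.disp_t) (V : orderType d) (T I : finType).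
Variables (S : {set I}) (f : I -> T -> V).

Definition strict_except (c : I -> V) (i : I) (x : T) : bool :=
  [forall j in S, (j != i) ==> (f j x < c j)].

Lemma strict_exceptP c i x :
  reflect {in S, forall j, j != i -> f j x < c j} (strict_except c i x).
Proof.
apply: (iffP forall_inP) => [lt_x j jS|lt_x j jS].
  by move/implyP: (lt_x j jS).
by apply/implyP; exact: lt_x.
Qed.

Lemma strict_threshold i (v : V) z : v < f i z ->
  exists c, forall x, (f i x < c) = (f i x <= v).
Proof.
move=> lt_vz; case: (@arg_minP _ _ _ z (fun x => v < f i x) (f i) lt_vz).
move=> y lt_vy y_min; exists (f i y) => x; apply/idP/idP => [|le_xv].
  by apply: contraTT; rewrite -ltNge -leNgt; exact: y_min.
exact: le_lt_trans lt_vy.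
Qed.

(** The new bound of the constraint a is the least value of [f a] at the points
    that only violate the constraint a: it is attained, and relaxing the
    constraint up to it, exclusively, admits no new point. *)
Lemma push_constraint (c : I -> V) a :
    a \in S ->
    {in S, forall i, exists2 z, c i <= f i z & strict_except c i z} ->
  exists c' : I -> V,
    [/\ forall i, i != a -> c' i = c i,
        c a <= c' a,
        exists2 z, f a z = c' a & strict_except c a z
      & forall x, {in S, forall i, f i x < c' i} <->
                  {in S, forall i, f i x < c i}].
Proof.
move=> aS /(_ a aS)[z0 le_z0 ex_z0].
pose P x := (c a <= f a x) && strict_except c a x.
have Pz0 : P z0 by rewrite /P le_z0.
case: (@arg_minP _ _ _ z0 P (f a) Pz0) => z /andP[le_z ex_z] z_min.
exists (fun i => if i == a then f a z else c i); split.
- by move=> i /negbTE->.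
- by rewrite eqxx.
- by exists z; rewrite ?eqxx.
move=> x; split=> lt_x i iS; last first.
  by case: eqP (lt_x i iS) => [->|//] lt_a; exact: lt_le_trans le_z.
have := lt_x i iS; case: (eqVneq i a) => [-> lt_xz|//].
rewrite ltNge; apply/negP => le_x; move: lt_xz; apply/negP; rewrite -leNgt.
apply: z_min; rewrite /P le_x; apply/strict_exceptP => j jS /negbTE ne_ja.
by have := lt_x j jS; rewrite ne_ja.
Qed.

(** The constraints are first made strict and then pushed in turn.  Relaxing a
    constraint preserves the witnesses of the other ones, tight or not, so
    pushing the next constraint does not undo the previous pushes. *)
Lemma exists_tight_witnesses (b : I -> V) :
    {in S, forall i, exists2 z, b i < f i z &
      {in S, forall j, j != i -> f j z <= b j}} ->
  exists c : I -> V,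
    (forall x, {in S, forall i, f i x < c i} <->
               {in S, forall i, f i x <= b i}) /\
    {in S, forall i, exists2 z, f i z = c i & strict_except c i z}.
Proof.
move=> wit.
have /fin_all_exists[c0 c0P] : forall i, exists c, i \in S ->
    forall x, (f i x < c) = (f i x <= b i).
  move=> i; have [iS|] := boolP (i \in S); last by exists (b i).
  have [z lt_z _] := wit i iS.
  by have [c cP] := strict_threshold lt_z; exists c.
(* r lists the constraints that have been pushed. *)
suff push_seq (r : seq I) : {subset r <= S} -> exists c : I -> V,
    [/\ forall x, {in S, forall i, f i x < c i} <->
                  {in S, forall i, f i x <= b i},
        {in S, forall i, exists2 z, c i <= f i z & strict_except c i z}
      & {in r, forall i, exists2 z, f i z = c i & strict_except c i z}].
  have [|c [eq_sol _ tight]] := push_seq (enum S).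
    by move=> i; rewrite mem_enum.
  by exists c; split=> // i iS; apply: tight; rewrite mem_enum.
elim: r => [_|a r IHr sub_arS].
  exists c0; split=> //.
    by move=> x; split=> le_x i iS; have := le_x i iS; rewrite c0P.
  move=> i iS; have [z lt_z le_z] := wit i iS; exists z.
    by rewrite leNgt c0P // -ltNge.
  by apply/strict_exceptP => j jS ne_ji; rewrite c0P // le_z.
have aS : a \in S by apply: sub_arS; rewrite mem_head.
have [|c [eq_sol weak tight]] := IHr.
  by move=> i ir; apply: sub_arS; rewrite in_cons ir orbT.
have [c' [c'E le_c' [z fz ex_z] eq_sol']] := push_constraint aS weak.
have c_le_c' i : c i <= c' i.
  by case: (eqVneq i a) => [->//|/c'E->].
have mono i x : strict_except c i x -> strict_except c' i x.
  move/strict_exceptP=> lt_x; apply/strict_exceptP => j jS ne_ji.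
  exact: lt_le_trans (lt_x j jS ne_ji) (c_le_c' j).
have tight_a : exists2 z, f a z = c' a & strict_except c' a z.
  by exists z => //; exact: mono.
exists c'; split.
- by move=> x; apply: iff_trans (eq_sol' x) (eq_sol x).
- move=> i iS; case: (eqVneq i a) => [->|ne_ia].
    by have [y <- ex_y] := tight_a; exists y.
  by have [y le_y /mono ex_y] := weak i iS; exists y => //; rewrite c'E.
move=> i; rewrite inE => /predU1P[->//|ir].
case: (eqVneq i a) => [->//|ne_ia].
by have [y fy /mono ex_y] := tight i ir; exists y => //; rewrite c'E.
Qed.
End TightWitnesses.

Local Open Scope ring_scope.

(** The tight witnesses and the points of Y form a set U to which
    [leq_card_midpoint_closed] applies: two distinct points of U are not both
    tight for the same constraint, so their midpoint satisfies all the
    constraints strictly. *)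
Lemma card_critical_constraints (R : realDomainType) (n N m : nat)
    (f : 'I_m -> {ffun 'I_n -> 'I_N.+1} -> R) (b : 'I_m -> R) (S : {set 'I_m})
    (Y := [set t | [forall i in S, f i t <= b i]]%SET) :
    (forall i t u, parity t = parity u ->
       f i (midpoint t u) *+ 2 = f i t + f i u) ->
    {in S, forall i, exists2 z, b i < f i z &
      {in S, forall j, j != i -> f j z <= b j}} ->
  (#|S| + #|Y| <= (2 ^ n).-1 * (#|Y| + 3)./2 + (#|Y| + 2)./2)%N.
Proof.
move=> f_mid /exists_tight_witnesses[c [eq_sol tight]].
have memY t : t \in Y <-> {in S, forall i, f i t < c i}.
  rewrite inE; split=> [/forall_inP/eq_sol//|lt_t].
  by apply/forall_inP; apply/eq_sol.
have /fin_all_exists[z zP] : forall i, exists z, i \in S ->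
    f i z = c i /\ strict_except S f c i z.
  move=> i; have [iS|] := boolP (i \in S); last by exists [ffun=> ord0].
  by have [z fz ex_z] := tight i iS; exists z.
have z_tight i : i \in S -> f i (z i) = c i by move=> /zP[].
have z_strict i j : i \in S -> j \in S -> j != i -> f j (z i) < c j.
  by move=> /zP[_ /strict_exceptP]; apply.
have z_inj : {in S &, injective z}.
  move=> i j iS jS eq_z; apply/eqP/negPn/negP => ne_ij.
  by have := z_strict j i jS iS ne_ij; rewrite -eq_z z_tight // ltxx.
have disj : [disjoint z @: S & Y].
  rewrite disjoint_subset; apply/fintype.subsetP => _ /imsetP[i iS ->].
  by apply/negP => /memY/(_ i iS); rewrite z_tight // ltxx.
have -> : (#|S| + #|Y| = #|z @: S :|: Y|)%N.
  rewrite cardsU card_in_imset //.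
  by move: disj; rewrite -setI_eq0 => /eqP->; rewrite cards0 subn0.
have tight_or_strict i u : i \in S -> u \in z @: S :|: Y ->
    f i u < c i \/ f i u = c i /\ u = z i.
  move=> iS /finset.setUP[/imsetP[j jS ->]|/memY lt_u]; last first.
    by left; exact: lt_u.
  case: (eqVneq i j) => [->|ne_ij]; last by left; exact: z_strict.
  by right; split=> //; exact: z_tight.
apply: leq_card_midpoint_closed; first exact: finset.subsetUr.
move=> u w uU wU ne_uw eq_par; apply/memY => i iS.
rewrite -(ltr_pMn2r (isT : 0 < 2)%N) f_mid // mulr2n.
case: (tight_or_strict i u iS uU) (tight_or_strict i w iS wU) ne_uw.
  move=> lt_u [lt_w _|[-> _] _]; [exact: ltrD|by rewrite ltrD2r].
by move=> [-> ->] [lt_w _|[_ ->]]; [rewrite ltrD2l|rewrite eqxx].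
Qed.

(** * The numerical bound *)

(** With h = floor((k+3)/2) and q = ceil(2(k+1)/3), the hypothesis reads
    s <= h (2^n - 2) + 2, and h <= q.  The case n = 0 is apart because 2^n - 2
    is then negative, but there the hypothesis forces k <= 2, where h = q. *)
Lemma leq_quant_bound n k s :
  (s + k <= (2 ^ n).-1 * (k + 3)./2 + (k + 2)./2)%N -> s%:Z <= quant_bound n k.
Proof.
rewrite /quant_bound /=; set x : rat := 2 * (k%:R + 1) / 3.
have /andP[lt_q le_q] := ceil_itv x; set q := Num.ceil x in lt_q le_q *.
rewrite /x in lt_q le_q.
have lb_q : 2 * (k%:Z + 1) <= 3 * q.
  rewrite -(ler_int rat) !rmorphM /= rmorphD /=; move: le_q; clear; lra.
have ub_q : 3 * q < 2 * (k%:Z + 1) + 3.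
  rewrite -(ltr_int rat) !(rmorphM, rmorphD) /=.
  move: lt_q; rewrite rmorphB /=; clear; lra.
have -> : 2 ^+ n = (2 ^ n)%N%:Z by rewrite -(natrX _ 2 n) natz.
move=> le_s; clear -lb_q ub_q le_s.
have : (0 < 2 ^ n)%N by rewrite expn_gt0.
case: n le_s => [|n]; first by rewrite expn0 mul0n; lia.
rewrite expnS; move: (2 ^ n)%N => p le_s p_gt0.
set h := (k + 3)./2 in le_s.
have le_hq : h%:Z <= q by lia.
have le_2h : (h + (k + 2)./2 = k + 2)%N by lia.
nia.
Qed.

(** * Integer points in a box *)

Section IntegerGrid.
Variables (R : realType) (n : nat).

(** The integer points of the box [-B, B]^n, shifted to nonnegative
    coordinates. *)
Definition grid_point B (t : {ffun 'I_n -> 'I_B.*2.+1}) : 'cV[R]_n :=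
  \col_j ((t j)%:R - B%:R).

Lemma grid_point_inj B : injective (@grid_point B).
Proof.
move=> t u eq_tu; apply/ffunP => j; apply: val_inj => /=.
by move/colP/(_ j)/eqP: eq_tu; rewrite !mxE (inj_eq (addIr _)) eqr_nat => /eqP.
Qed.

Lemma grid_point_midpoint B (t u : {ffun 'I_n -> 'I_B.*2.+1}) :
  parity t = parity u ->
  grid_point (midpoint t u) *+ 2 = grid_point t + grid_point u.
Proof.
move=> eq_par; apply/colP => j; rewrite mulmxnE !mxE.
have /(congr1 (fun m => m%:R : R)) := midpointE j eq_par.
by rewrite -muln2 natrM natrD -mulr_natr; lra.
Qed.

Lemma grid_point_int B t j : @grid_point B t j 0 \is a Num.int.
Proof. by rewrite mxE rpredB ?natr_int. Qed.

Lemma grid_point_surj B (x : 'cV[R]_n) :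
    (forall j, x j 0 \is a Num.int) -> (forall j, `|x j 0| <= B%:R) ->
  exists t, @grid_point B t = x.
Proof.
move=> int_x le_x.
have /fin_all_exists[t tP] : forall j, exists t : 'I_B.*2.+1,
    t%:R - B%:R = x j 0.
  move=> j; have /intrP[z xz] := int_x j; have := le_x j; rewrite xz.
  rewrite -intr_norm -[B%:R]/(B%:Z%:~R) ler_int => le_z.
  exists (inord `|(z + B%:Z)%R|); rewrite inordK; last by lia.
  by rewrite pmulrn -mulrzBr; congr (_%:~R); lia.
exists [ffun j => t j]; apply/colP => j.
by rewrite mxE ffunE tP.
Qed.

Lemma exists_coordinate_bound (X : set 'cV[R]_n) : finite_set X ->
  exists B : nat, forall x, X x -> forall j, `|x j 0| <= B%:R.
Proof.
case/finite_seqP=> s ->.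
exists (\max_(x <- s) \max_j Num.bound `|x j 0%R|)%N => x /= xs j.
apply: le_trans (ltW (archi_boundP (normr_ge0 _))) _.
rewrite ler_nat; apply: leq_trans (leq_bigmax_seq (P := predT) _ xs isT).
exact: (leq_bigmax (F := fun j => Num.bound `|x j 0|)).
Qed.

End IntegerGrid.

(** * Irredundant rows of a polyhedron *)

Section RowSelection.
Variables (R : realType) (m n : nat) (A : 'M[R]_(m, n)) (b : 'cV[R]_m).

Lemma mem_subrows (S : {set 'I_m}) x :
  polyhedron (subrows S A) (subrows S b) x <->
  {in S, forall i, (A *m x) i 0 <= b i 0}.
Proof.
rewrite /polyhedron /subrows /= mul_rowsub_mx; split=> [le_x i iS|le_x i].
  by have := le_x (enum_rank_in iS i); rewrite !mxE enum_rankK_in // mxE.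
by have := le_x _ (enum_valP i); rewrite !mxE.
Qed.

(** An inclusion-minimal set of rows with the right integer points: dropping the
    row i lets in a new integer point, which then violates the row i only. *)
Lemma exists_irredundant_rows : exists S : {set 'I_m},
  integer_points (polyhedron (subrows S A) (subrows S b)) =
    integer_points (polyhedron A b) /\
  {in S, forall i, exists x : 'cV[R]_n,
    [/\ forall j, x j 0 \is a Num.int, b i 0 < (A *m x) i 0
      & {in S, forall j, j != i -> (A *m x) j 0 <= b j 0}]}.
Proof.
pose same (S : {set 'I_m}) :=
  `[< integer_points (polyhedron (subrows S A) (subrows S b)) =
      integer_points (polyhedron A b) >].
have same_setT : same [set: 'I_m]%SET.
  apply/asboolP; apply/seteqP; split=> x [Px int_x]; split=> //.
    by move=> i; apply: ((mem_subrows _ x).1 Px).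
  by apply/mem_subrows => i _; exact: Px.
have [S /minsetP[/asboolP eqS minS]] :=
  @ex_minset _ same (ex_intro same _ same_setT).
exists S; split=> // i iS; apply: contrapT => no_wit.
suff /minS/(_ (finset.subD1set S i)) : same (S :\ i)%SET.
  by move=> /finset.setP/(_ i); rewrite !inE iS eqxx.
apply/asboolP; rewrite -eqS; apply/seteqP; split=> x [/mem_subrows Px int_x].
  split=> //; apply/mem_subrows => j jS.
  case: (eqVneq j i) => [->|ne_ji]; last by apply: Px; rewrite !inE ne_ji.
  rewrite leNgt; apply/negP => lt_x; apply: no_wit; exists x; split=> //.
  by move=> l lS ne_li; apply: Px; rewrite !inE ne_li.
by split=> //; apply/mem_subrows => j /finset.setD1P[_]; exact: Px.
Qed.

End RowSelection.

(** * The bound *)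

Lemma quant_doignon_constant_quant_bound (R : realType) (n k : nat) :
  quant_doignon_constant R n k (quant_bound n k).
Proof.
move=> m A b card_k; have [S [eqS wit]] := exists_irredundant_rows A b.
exists S; split=> //; apply: leq_quant_bound.
have /fin_all_exists[z zP] : forall i, exists z : 'cV[R]_n, i \in S ->
    [/\ forall j, z j 0 \is a Num.int, b i 0 < (A *m z) i 0
      & {in S, forall j, j != i -> (A *m z) j 0 <= b j 0}].
  move=> i; have [iS|] := boolP (i \in S); last by exists 0.
  by have [z zP] := wit i iS; exists z.
(* The box has to contain both the integer points and the witnesses. *)
have [B bound_B] : exists B : nat, forall x,
    (integer_points (polyhedron A b) `|` range z)%classic x ->
    forall j, `|x j 0| <= B%:R.
  apply: exists_coordinate_bound; rewrite finite_setU; split.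
    by apply/finite_setP; exists k.
  exact: finite_image.
pose f i t := (A *m @grid_point R n B t) i 0.
pose Y := [set t | [forall i in S, f i t <= b i 0]]%SET.
have imY : integer_points (polyhedron A b) =
    (@grid_point R n B @` [set` Y])%classic.
  rewrite -eqS; apply/seteqP; split=> [x Px|_ [t /= tY <-]].
    have [t tx] : exists t, @grid_point R n B t = x.
      apply: grid_point_surj; first by case: Px.
      by apply: bound_B; left; rewrite -eqS.
    exists t => //=; rewrite inE; apply/forall_inP => i iS.
    by rewrite /f tx; case: Px => /mem_subrows Px _; exact: Px.
  split; last exact: grid_point_int.
  by apply/mem_subrows => i iS; move: tY; rewrite inE => /forall_inP/(_ i iS).
have -> : k = #|Y|.
  rewrite -(finmap.card_finset (mem Y)); apply/esym/card_eq_fsetP.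
  apply: card_eq_trans card_k; rewrite imY card_eq_sym.
  rewrite (_ : [set` _]%classic = [set` Y]%classic); last first.
    by apply/seteqP; split=> t /=; rewrite !inE.
  by apply: inj_card_eq => t u _ _; exact: grid_point_inj.
apply: card_critical_constraints => [i t u eq_par|i iS].
  by rewrite /f -mulmxnE -raddfMn /= grid_point_midpoint // mulmxDr mxE.
have [int_z lt_z le_z] := zP i iS.
have [t tz] : exists t, @grid_point R n B t = z i.
  by apply: grid_point_surj => //; apply: bound_B; right; exists i.
by exists t; rewrite /f tz.
Qed.

Theorem theorem1 (R : realType) (n k : nat) :
  (exists c : int,
     quant_doignon_constant R n k c /\ c <= quant_bound n k) /\
  (forall c : int,
     quant_doignon_constant R n k c ->
     (forall c' : int, quant_doignon_constant R n k c' -> c <= c') ->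
     c <= quant_bound n k).
Proof.
have bound_ok := @quant_doignon_constant_quant_bound R n k.
by split=> [|c _ /(_ _ bound_ok)//]; exists (quant_bound n k).
Qed.
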